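(* Let $p$ be a prime and $R$ a perfect $\mathbb{F}_p$-algebra, equipped with the trivial norm, and equip $W(R)$ with the $p$-adic norm. Define $\lambda:\mathcal{M}(R)\to\mathcal{M}(W(R))$ and $\mu:\mathcal{M}(W(R))\to\mathcal{M}(R)$ by \[\lambda(\alpha)\Big(\sum_{i\ge 0}p^i[\overline{x_i}]\Big)=\max_i\{p^{-i}\alpha(\overline{x_i})\},\qquad \mu(\beta)(\overline{x})=\beta([\overline{x}]).\] Then: (a) $\lambda$ and $\mu$ are strongly continuous and monotonic (for the pointwise order on seminorms); (b) for all $\alpha\in\mathcal{M}(R)$, $\mu(\lambda(\alpha))=\alpha$; (c) for all $\beta\in\mathcal{M}(W(R))$, $\lambda(\mu(\beta))\ge\beta$ pointwise.
   Context: A seminorm on an abelian group $G$ is a map $\alpha:G\to[0,\infty)$ with $\alpha(0)=0$ and $\alpha(g-h)\le\max\{\alpha(g),\alpha(h)\}$; it is a norm if $\alpha(g)=0$ only for $g=0$. A seminorm $\alpha$ on a ring is multiplicative if $\alpha(1)\le 1$ and $\alpha(gh)=\alpha(g)\alpha(h)$ for all $g,h$. The trivial norm sends $0$ to $0$ and nonzero elements to $1$. For a ring $A$ with a submultiplicative norm $|\cdot|$ (i.e. $|1|\le1$, $|gh|\le|g||h|$), the Gel'fand spectrum $\mathcal{M}(A)$ is the set of multiplicative seminorms $\alpha$ on $A$ with $\alpha(a)\le|a|$ for all $a$, topologized as a subspace of $\prod_{a\in A}[0,|a|]$. A Weierstrass subspace of $\mathcal{M}(A)$ is one of the form $\{\alpha:\alpha(f_i)\le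 p_i,\ i=1,\dots,n\}$ with $f_i\in A$, $p_i>0$; a Laurent subspace is one of the form $\{\alpha:\alpha(f_i)\le p_i,\ \alpha(g_j)\ge q_j\}$ with finitely many $f_i,g_j\in A$, $p_i,q_j>0$; a rational subspace is one of the form $\{\alpha:\alpha(f_i)\le p_i\alpha(g),\ i=1,\dots,n\}$ where $f_1,\dots,f_n,g\in A$ generate the unit ideal in the completion of $A$ and $p_i>0$. A continuous map between Gel'fand spectra is strongly continuous if the inverse image of any Weierstrass (resp. Laurent, rational) subspace is a finite union of Weierstrass (resp. Laurent, rational) subspaces. $R$ perfect means the $p$-th power map is bijective. $W(R)$ is the ring of $p$-typical Witt vectors: the unique (up to unique isomorphism) $p$-torsion-free, $p$-adically complete and separated ring with $W(R)/pW(R)\cong R$. For $\overline{x}\in R$, $[\overline{x}]\in W(R)$ is the Teichmüller lift (the unique lift of $\overline{x}$ admitting a $p^n$-th root for every $n$); the map $[\cdot]$ is multiplicative, and every element of $W(R)$ has a unique expansion $\sum_{i\ge0}p^i[\overline{x_i}]$ with $\overline{x_i}\in R$. The $p$-adic norm on $W(R)$ is normalized by $|p|=p^{-1}$. *)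

(* Defs.v *)
From HB Require Import structures.
From mathcomp Require Import all_boot all_order all_algebra.
From mathcomp Require Import all_classical all_reals all_analysis.

Set Implicit Arguments.
Unset Strict Implicit.
Unset Printing Implicit Defensive.

Import Order.TTheory GRing.Theory Num.Theory numFieldNormedType.Exports.

Local Open Scope classical_set_scope.
Local Open Scope ring_scope.

Section Norms.
Variable K : realType.

(* Rings are commutative and may be trivial, hence [comPzRingType]. *)

Record is_seminorm (G : zmodType) (alpha : G -> K) : Prop := IsSeminorm {
  seminorm_ge0 : forall g, 0 <= alpha g ;
  seminorm0 : alpha 0 = 0 ;
  seminormB : forall g h, alpha (g - h) <= Num.max (alpha g) (alpha h) }.

Definition is_norm (G : zmodType) (alpha : G -> K) : Prop :=
  is_seminorm alpha /\ forall g, alpha g = 0 -> g = 0.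

Definition submultiplicative (A : comPzRingType) (alpha : A -> K) : Prop :=
  alpha 1 <= 1 /\ forall g h, alpha (g * h) <= alpha g * alpha h.

Definition multiplicative (A : comPzRingType) (alpha : A -> K) : Prop :=
  alpha 1 <= 1 /\ forall g h, alpha (g * h) = alpha g * alpha h.

Definition trivial_norm (A : comPzRingType) (a : A) : K :=
  if a == 0 then 0 else 1.

(* The set is {p^-m | m <= v_p(a)}, so that the infimum is p^-v_p(a), and is 0
   when a lies in every p^m A. *)
Definition padic_norm (p : nat) (A : comPzRingType) (a : A) : K :=
  inf [set r | exists2 m : nat, (exists b : A, a = p%:R ^+ m * b)
                              & r = p%:R ^- m].

(* The identically zero seminorm is not excluded. *)
Definition gelfand (A : comPzRingType) (nA : A -> K) : set {ptws A -> K} :=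
  [set alpha | [/\ is_seminorm (alpha : A -> K),
                   multiplicative (alpha : A -> K)
                 & forall a, alpha a <= nA a]].

Definition cauchy_for (B : zmodType) (nB : B -> K) (u : nat -> B) : Prop :=
  forall e : K, 0 < e ->
    exists N : nat, forall m n : nat, (N <= m)%N -> (N <= n)%N ->
      nB (u m - u n) < e.

Definition converges_for (B : zmodType) (nB : B -> K) (u : nat -> B) (l : B) :
    Prop :=
  forall e : K, 0 < e ->
    exists N : nat, forall n : nat, (N <= n)%N -> nB (u n - l) < e.

(* Characterizes the completion up to unique isometric isomorphism. *)
Record is_completion (A : comPzRingType) (nA : A -> K)
    (B : comPzRingType) (nB : B -> K) (j : {rmorphism A -> B}) : Prop :=
  IsCompletion {
    completion_norm : is_norm nB ;
    completion_submult : submultiplicative nB ;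
    completion_isometric : forall a, nB (j a) = nA a ;
    completion_dense : forall b (e : K), 0 < e -> exists a, nB (b - j a) < e ;
    completion_complete : forall u, cauchy_for nB u ->
                            exists l, converges_for nB u l }.

Definition unit_ideal_in_completion (A : comPzRingType) (nA : A -> K)
    (n : nat) (f : 'I_n -> A) (g : A) : Prop :=
  exists (B : comPzRingType) (nB : B -> K) (j : {rmorphism A -> B}),
    is_completion nA nB j /\
    exists (c : 'I_n -> B) (d : B), \sum_i c i * j (f i) + d * j g = 1.

Section Subspaces.
Variables (A : comPzRingType) (nA : A -> K).

Definition weierstrass (U : set (gelfand nA)) : Prop :=
  exists (n : nat) (f : 'I_n -> A) (p : 'I_n -> K),
    (forall i, 0 < p i) /\
    U = [set alpha | forall i, val alpha (f i) <= p i].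

Definition laurent (U : set (gelfand nA)) : Prop :=
  exists (m n : nat) (f : 'I_m -> A) (p : 'I_m -> K)
         (g : 'I_n -> A) (q : 'I_n -> K),
    [/\ forall i, 0 < p i, forall j, 0 < q j
      & U = [set alpha | (forall i, val alpha (f i) <= p i) /\
                         (forall j, q j <= val alpha (g j))]].

Definition rational (U : set (gelfand nA)) : Prop :=
  exists (n : nat) (f : 'I_n -> A) (g : A) (p : 'I_n -> K),
    [/\ unit_ideal_in_completion nA f g, forall i, 0 < p i
      & U = [set alpha | forall i, val alpha (f i) <= p i * val alpha g]].

End Subspaces.

Definition finite_union_of (T : Type) (P : set T -> Prop) (U : set T) : Prop :=
  exists (n : nat) (V : 'I_n -> set T),
    (forall i, P (V i)) /\ U = \bigcup_i V i.

Definition strongly_continuous (A B : comPzRingType) (nA : A -> K)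
    (nB : B -> K) (phi : gelfand nA -> gelfand nB) : Prop :=
  [/\ continuous phi,
      forall U, weierstrass U -> finite_union_of (@weierstrass A nA) (phi @^-1` U),
      forall U, laurent U -> finite_union_of (@laurent A nA) (phi @^-1` U)
    & forall U, rational U -> finite_union_of (@rational A nA) (phi @^-1` U)].

Definition monotonic (A B : comPzRingType) (nA : A -> K) (nB : B -> K)
    (phi : gelfand nA -> gelfand nB) : Prop :=
  forall alpha alpha' : gelfand nA,
    (forall a, val alpha a <= val alpha' a) ->
    forall b, val (phi alpha) b <= val (phi alpha') b.

Definition is_max (S : set K) (m : K) : Prop := S m /\ ubound S m.

End Norms.

Section WittVectors.
Variables (p : nat) (R W : comPzRingType) (pi : {rmorphism W -> R}).

Definition congr_mod_pow (n : nat) (x y : W) : Prop :=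
  exists z, x - y = p%:R ^+ n * z.

(* W is "the" ring of p-typical Witt vectors of the perfect ring R, with
   reduction map pi inducing W / pW ~ R. *)
Record is_witt_ring : Prop := IsWittRing {
  witt_torsion_free : forall w : W, p%:R * w = 0 -> w = 0 ;
  witt_separated : forall w : W, (forall n, congr_mod_pow n w 0) -> w = 0 ;
  witt_complete : forall u : nat -> W,
    (forall n, congr_mod_pow n (u n.+1) (u n)) ->
    exists l, forall n, congr_mod_pow n l (u n) ;
  witt_pi_surj : forall x : R, exists w, pi w = x ;
  witt_pi_ker : forall w : W, pi w = 0 <-> congr_mod_pow 1 w 0 }.

(* The default value 0 is never used when R is perfect and [is_witt_ring]
   holds: the lift then exists and is unique. *)
Definition teichmuller (x : R) : W :=
  xget 0 [set w | pi w = x /\ forall n : nat, exists v, v ^+ (p ^ n)%N = w].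

(* w = \sum_(i >= 0) p^i [x i], the series converging p-adically *)
Definition teichmuller_expansion (w : W) (x : nat -> R) : Prop :=
  forall n : nat,
    congr_mod_pow n w (\sum_(i < n) p%:R ^+ i * teichmuller (x i)).

End WittVectors.

(* Main.v *)
(* Every w in W has a unique Teichmüller expansion with digits x_i, and
   lambda(alpha)(w) <= c iff alpha(x_i) <= c p^i for all i.  That such w are
   closed under addition is proved modulo p^n by induction on n, for all c at
   once: [x] + [y] - [x + y] is p times a combination of [z] with
   alpha(z) <= max(alpha(x), alpha(y)), because [x + y] is the limit of the
   p^n-th powers of [x^(1/p^n)] + [y^(1/p^n)].  This replaces the homogeneity
   of the Witt vector addition polynomials.  Multiplicativity follows by
   splitting both factors at their first digit of maximal weight.  Since
   p^-i alpha(x_i) <= p^-i, each inequality on lambda(alpha)(w) involves only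
   finitely many digits, whence strong continuity. *)

Require Import Defs.
From HB Require Import structures.
From mathcomp Require Import all_boot all_order all_algebra.
From mathcomp Require Import all_classical all_reals all_analysis.

Set Implicit Arguments.
Unset Strict Implicit.
Unset Printing Implicit Defensive.

Import Order.TTheory GRing.Theory Num.Theory numFieldNormedType.Exports.

Local Open Scope classical_set_scope.
Local Open Scope ring_scope.

(** * Binomial expansion of a p^n-th power *)

Lemma prime_dvd_bin_pow (p n k : nat) :
  prime p -> (0 < k < p ^ n)%N -> (p %| 'C(p ^ n, k))%N.
Proof.
move=> p_pr /andP[k_gt0 k_lt]; rewrite -[(_ %| _)%N]negbK -prime_coprime //.
apply/negP => cop.
(* The identity k C(p^n, k) = p^n C(p^n - 1, k - 1) makes p^n divide k C(p^n, k), and the binomial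
   coefficient is coprime to p^n. *)
suff /(dvdn_leq k_gt0) : (p ^ n %| k)%N by rewrite leqNgt k_lt.
rewrite -(@Gauss_dvdl _ _ 'C(p ^ n, k)) ?coprimeXl //.
by case: k k_gt0 k_lt {cop} => // k _ _; rewrite -mul_bin_diag dvdn_mulr.
Qed.

(** The explicit factor p serves twice: in R it makes the p^n-th power additive, and in W it
    exhibits the carry of a sum of Teichmüller representatives. *)
Lemma exprD_ppow (A : comPzRingType) (p n : nat) (x y : A) : prime p ->
  (x + y) ^+ (p ^ n) = x ^+ (p ^ n) + y ^+ (p ^ n)
    + p%:R * \sum_(k < (p ^ n).-1)
        ('C(p ^ n, k.+1) %/ p)%:R * (x ^+ (p ^ n - k.+1) * y ^+ k.+1).
Proof.
move=> p_pr; have : (0 < p ^ n)%N by rewrite expn_gt0 prime_gt0.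
case E: (p ^ n)%N => [//|m] _; rewrite exprDn big_ord_recl big_ord_recr /=.
rewrite bin0 binn !subn0 subnn !mulr1n mulr1 mul1r addrA addrAC.
congr (_ + _); rewrite mulr_sumr; apply: eq_bigr => k _.
rewrite /bump /= mulrA -natrM mulnC divnK ?mulr_natl //.
by rewrite -E prime_dvd_bin_pow // E; exact: ltn_ord k.
Qed.

(** * Congruences modulo powers of p *)

Section Congruences.
Variables (p : nat) (W : comPzRingType).
Implicit Types (x y z : W) (n m : nat).
Local Notation cg := (@congr_mod_pow p W).

Lemma congr_refl n x : cg n x x.
Proof. by exists 0; rewrite subrr mulr0. Qed.

Lemma congr_sym n x y : cg n x y -> cg n y x.
Proof. by move=> [z E]; exists (- z); rewrite mulrN -E opprB. Qed.

Lemma congr_trans n y x z : cg n x y -> cg n y z -> cg n x z.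
Proof.
by move=> [u E] [v F]; exists (u + v); rewrite mulrDr -E -F addrA subrK.
Qed.

Lemma congrD n x y x' y' : cg n x y -> cg n x' y' -> cg n (x + x') (y + y').
Proof.
by move=> [u E] [v F]; exists (u + v); rewrite mulrDr -E -F opprD addrACA.
Qed.

Lemma congrN n x y : cg n x y -> cg n (- x) (- y).
Proof. by move=> [u E]; exists (- u); rewrite mulrN -E opprB opprK addrC. Qed.

Lemma congrM n x y x' y' : cg n x y -> cg n x' y' -> cg n (x * x') (y * y').
Proof.
move=> [u E] [v F]; exists (u * x' + y * v).
by rewrite mulrDr mulrA -E mulrCA -F mulrBl mulrBr addrA subrK.
Qed.

Lemma congrX n x y k : cg n x y -> cg n (x ^+ k) (y ^+ k).
Proof.
move=> E; elim: k => [|k IH]; first exact: congr_refl.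
by rewrite !exprS; apply: congrM.
Qed.

Lemma congr_le m n x y : (m <= n)%N -> cg n x y -> cg m x y.
Proof.
move=> mn [u E]; exists (p%:R ^+ (n - m) * u).
by rewrite E mulrA -exprD subnKC.
Qed.

Lemma congr0 x y : cg 0 x y.
Proof. by exists (x - y); rewrite mul1r. Qed.

Lemma congr_pow_mul n x : cg n (p%:R ^+ n * x) 0.
Proof. by exists x; rewrite subr0. Qed.

Lemma congr_subr0 n x y : cg n (x - y) 0 <-> cg n x y.
Proof. by split=> -[z E]; exists z; [rewrite -E subr0|rewrite subr0]. Qed.

End Congruences.

(** * Seminorms and Gel'fand spectra *)

Section Seminorms.
Variables (K : realType) (G : zmodType) (alpha : G -> K).
Hypothesis alphaP : is_seminorm alpha.

Lemma seminormN x : alpha (- x) = alpha x.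
Proof.
suff H y : alpha (- y) <= alpha y.
  by apply/le_anti; rewrite H -{1}[x]opprK H.
have := seminormB alphaP 0 y.
by rewrite sub0r (seminorm0 alphaP) max_r // seminorm_ge0.
Qed.

Lemma seminormD x y : alpha (x + y) <= Num.max (alpha x) (alpha y).
Proof. by have := seminormB alphaP x (- y); rewrite opprK seminormN. Qed.

Lemma seminorm_sum (I : finType) (f : I -> G) c :
  0 <= c -> (forall i, alpha (f i) <= c) -> alpha (\sum_i f i) <= c.
Proof.
move=> c0 fc; apply: (big_ind (fun x => alpha x <= c)) => //.
  by rewrite (seminorm0 alphaP).
by move=> x y xc yc; apply: le_trans (seminormD x y) _; rewrite ge_max xc.
Qed.

End Seminorms.

Section Gelfand.
Variables (K : realType) (A : comPzRingType) (nA : A -> K).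
Variable alpha : gelfand nA.

Lemma gelfandP :
  [/\ is_seminorm (val alpha : A -> K), Defs.multiplicative (val alpha : A -> K)
    & forall a, val alpha a <= nA a].
Proof. exact: set_valP alpha. Qed.

Lemma gelfand_seminorm : is_seminorm (val alpha : A -> K).
Proof. by case: gelfandP. Qed.

Lemma gelfand_ge0 a : 0 <= val alpha a.
Proof. exact: (seminorm_ge0 gelfand_seminorm). Qed.

Lemma gelfand_0 : val alpha 0 = 0.
Proof. exact: (seminorm0 gelfand_seminorm). Qed.

Lemma gelfandM a b : val alpha (a * b) = val alpha a * val alpha b.
Proof. by case: gelfandP => _ []. Qed.

Lemma gelfand_1_le : val alpha 1 <= 1.
Proof. by case: gelfandP => _ []. Qed.

Lemma gelfand_bound a : val alpha a <= nA a.
Proof. by case: gelfandP. Qed.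

Lemma gelfandXS a n : val alpha (a ^+ n.+1) = val alpha a ^+ n.+1.
Proof.
by elim: n => [|n IH]; rewrite ?expr1 // exprS [RHS]exprS gelfandM IH.
Qed.

(** The value at 1 is idempotent in the field K. The zero seminorm may be a point of the spectrum
    and has to be treated apart in the rational case. *)
Lemma gelfand_eq0_or1 : val alpha 1 = 1 \/ forall a, val alpha a = 0.
Proof.
have : val alpha 1 * (val alpha 1 - 1) = 0.
  by rewrite mulrBr mulr1 -gelfandM mulr1 subrr.
move=> /eqP; rewrite mulf_eq0 subr_eq0 => /orP[] /eqP E; last by left.
by right=> a; rewrite -[a]mulr1 gelfandM E mulr0.
Qed.

Lemma gelfand_continuous (X : topologicalType) (phi : X -> gelfand nA) :
  (forall a, continuous (fun x => val (phi x) a)) -> continuous phi.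
Proof.
move=> H; apply: continuous_comp_initial => x; apply/cvg_sup => a.
apply: (@continuous_comp_initial _ _ _ (fun f : {ptws A -> K} => f a)).
exact: H.
Qed.

End Gelfand.

Lemma continuous_gelfand_eval (K : realType) (A : comPzRingType) (nA : A -> K)
    (a : A) :
  continuous (fun alpha : gelfand nA => val alpha a).
Proof.
move=> alpha.
have H1 : {for alpha, continuous (val : gelfand nA -> {ptws A -> K})}.
  exact: initial_continuous.
have H2 : {for val alpha, continuous (fun f : {ptws A -> K} => f a)}.
  exact: proj_continuous.
exact: continuous_comp H1 H2.
Qed.

Lemma converges_unique (K : realType) (A : comPzRingType) (nA : A -> K)
    (x y : A) (u : nat -> A) : is_norm nA ->
  converges_for nA u x -> converges_for nA u y -> x = y.
Proof.
move=> [nS n0] ux uy; apply/eqP; rewrite -subr_eq0; apply/eqP/n0/le_anti.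
rewrite (seminorm_ge0 nS) andbT; apply/ler_addgt0Pl => e e0; rewrite addr0.
have [[N NP] [M MP]] := (ux e e0, uy e e0).
have -> : x - y = (u (N + M)%N - y) - (u (N + M)%N - x).
  by rewrite opprB [RHS]addrC addrA subrK.
apply: le_trans (seminormB nS _ _) _; rewrite ge_max.
by rewrite !ltW ?NP ?MP ?leq_addr ?leq_addl.
Qed.

(** * Finite families of inequalities and the unit ideal condition *)

Section FiniteFamilies.
Variables (K : realType) (A : comPzRingType) (nA : A -> K).

Lemma finite_union_of_fin (T : Type) (P : set T -> Prop) (I : finType)
    (V : I -> set T) :
  (forall i, P (V i)) -> finite_union_of P (\bigcup_i V i).
Proof.
move=> VP; exists #|I|, (V \o enum_val); split=> [i|]; first exact: VP.
apply/seteqP; split=> x [i _ Vx]; last by exists (enum_val i).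
by exists (enum_rank i); rewrite //= enum_rankK.
Qed.

Lemma finite_union_of1 (T : Type) (P : set T -> Prop) U :
  P U -> finite_union_of P U.
Proof.
move=> PU; have -> : U = \bigcup_(i in [set: unit]) U.
  by apply/seteqP; split=> x; [exists tt|case].
exact: finite_union_of_fin.
Qed.

(** General finite index types are convenient because preimages under lambda are indexed by pairs of
    an inequality and a digit. *)
Lemma weierstrass_fin (I : finType) (f : I -> A) (p : I -> K) :
  (forall i, 0 < p i) ->
  weierstrass [set alpha : gelfand nA | forall i, val alpha (f i) <= p i].
Proof.
move=> p0; exists #|I|, (f \o enum_val), (p \o enum_val); split=> [i|].
  exact: p0.
apply/seteqP; split=> alpha /= H i; first exact: H.
by have := H (enum_rank i); rewrite enum_rankK.
Qed.

Lemma laurent_fin (I J : finType) (f : I -> A) (p : I -> K)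
    (g : J -> A) (q : J -> K) :
  (forall i, 0 < p i) -> (forall j, 0 < q j) ->
  laurent [set alpha : gelfand nA | (forall i, val alpha (f i) <= p i) /\
                                    (forall j, q j <= val alpha (g j))].
Proof.
move=> p0 q0; exists #|I|, #|J|, (f \o enum_val), (p \o enum_val).
exists (g \o enum_val), (q \o enum_val); split=> [i|j|]; [exact: p0|exact: q0|].
apply/seteqP; split=> alpha /= [H H']; split=> i; try exact: H; try exact: H'.
  by have := H (enum_rank i); rewrite enum_rankK.
by have := H' (enum_rank i); rewrite enum_rankK.
Qed.

Lemma completion_of_complete :
  is_norm nA -> submultiplicative nA ->
  (forall u, cauchy_for nA u -> exists l, converges_for nA u l) ->
  is_completion nA nA idfun.
Proof.
move=> nN nM nC; split=> // b e e0; exists b.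
by rewrite subrr (seminorm0 nN.1).
Qed.

Lemma rational_fin (I : finType) (f : I -> A) (g : A) (p : I -> K) :
  is_completion nA nA idfun ->
  (exists (c : I -> A) (d : A), \sum_i c i * f i + d * g = 1) ->
  (forall i, 0 < p i) ->
  Defs.rational [set alpha : gelfand nA |
                  forall i, val alpha (f i) <= p i * val alpha g].
Proof.
move=> Ac [c [d cd]] p0; exists #|I|, (f \o enum_val), g, (p \o enum_val).
split=> [|i|]; [|exact: p0|].
- exists A, nA, idfun; split=> //; exists (c \o enum_val), d.
  rewrite -cd; congr (_ + _).
  by rewrite [RHS](reindex _ (onW_bij _ (enum_val_bij I))).
- apply/seteqP; split=> alpha /= H i; first exact: H.
  by have := H (enum_rank i); rewrite enum_rankK.
Qed.

(** The isometry j is injective because [nA] is a norm. It is surjective because approximants in A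
    of an element of B form a Cauchy sequence, which already converges in A. The relation therefore
    pulls back along j. *)
Lemma unit_ideal_of_complete n (f : 'I_n -> A) g :
  is_completion nA nA idfun -> unit_ideal_in_completion nA f g ->
  exists (c : 'I_n -> A) (d : A), \sum_i c i * f i + d * g = 1.
Proof.
move=> Ac [B [nB [j [Bc [c [d cd]]]]]].
have nBS := (completion_norm Bc).1.
have jinj x y : j x = j y -> x = y.
  move=> E; apply/eqP; rewrite -subr_eq0; apply/eqP/(completion_norm Ac).2.
  by rewrite -(completion_isometric Bc) rmorphB E subrr (seminorm0 nBS).
have jsurj b : exists a, j a = b.
  have /choice[u uP] n' : exists a, nB (b - j a) < n'.+1%:R^-1.
    by apply: (completion_dense Bc); rewrite invr_gt0 ltr0n.
  have ub : converges_for nB (j \o u) b.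
    move=> e e0; have [N NP] : exists N : nat, N.+1%:R^-1 < e.
      exists (Num.bound e^-1); rewrite invf_plt ?posrE ?ltr0n //.
      have: e^-1 < (Num.bound e^-1)%:R.
        by apply: archi_boundP; rewrite invr_ge0 ltW.
      by move=> /lt_trans; apply; rewrite ltr_nat.
    exists N => m Nm; rewrite -opprB (seminormN nBS).
    apply: lt_trans (uP m) (le_lt_trans _ NP).
    by rewrite lef_pV2 ?posrE ?ltr0n // ler_nat.
  have [|l ul] := completion_complete Ac (u := u).
    move=> e e0; have [N NP] := ub e e0; exists N => m k Nm Nk.
    rewrite -(completion_isometric Bc) rmorphB.
    have -> : j (u m) - j (u k) = (j (u m) - b) - (j (u k) - b).
      by rewrite opprB addrA subrK.
    by apply: le_lt_trans (seminormB nBS _ _) _; rewrite gt_max !NP.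
  exists l; have {ul} : converges_for nB (j \o u) (j l).
    move=> e e0; have [N NP] := ul e e0; exists N => m Nm.
    by rewrite /= -rmorphB (completion_isometric Bc) NP.
  by move=> ul; apply: converges_unique (completion_norm Bc) ul ub.
have /choice[c' cE] i : exists a, j a = c i by apply: jsurj.
have [d' dE] := jsurj d; exists c', d'; apply: jinj.
rewrite rmorph1 -cd rmorphD rmorph_sum rmorphM dE; congr (_ + _).
by apply: eq_bigr => i _; rewrite rmorphM cE.
Qed.

End FiniteFamilies.

(** * The trivial norm is complete *)

Section TrivialNorm.
Variables (K : realType) (A : comPzRingType).
Local Notation N := (@trivial_norm K A).

Lemma trivial_norm_le1 a : N a <= 1.
Proof. by rewrite /trivial_norm; case: ifP. Qed.

Lemma trivial_is_completion : is_completion N N idfun.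
Proof.
have N0 : N 0 = 0 by rewrite /trivial_norm eqxx.
have N1 a : a != 0 -> N a = 1 by rewrite /trivial_norm => /negPf ->.
have N_ge0 a : 0 <= N a by rewrite /trivial_norm; case: ifP.
apply: completion_of_complete.
- split=> [|a Na]; last by apply: contra_eq Na => /N1 ->; exact: oner_neq0.
  split=> // g h; have [->|g0] := eqVneq g 0; last first.
    by rewrite le_max (N1 g) // trivial_norm_le1.
  have [->|h0] := eqVneq h 0; first by rewrite subr0 N0 maxxx.
  by rewrite le_max (N1 h) // trivial_norm_le1 orbT.
- split=> [|g h]; first exact: trivial_norm_le1.
  have [->|g0] := eqVneq g 0; first by rewrite mul0r N0 mul0r.
  have [->|h0] := eqVneq h 0; first by rewrite mulr0 N0 mulr0.
  by rewrite (N1 g) // (N1 h) // mulr1 trivial_norm_le1.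
(* A trivial norm below 1 is zero, so u is constant from M on. *)
- move=> u uC; have [M MP] := uC 1 ltr01; exists (u M) => e e0.
  exists M => m Mm.
  have := MP m M Mm (leqnn M); rewrite /trivial_norm.
  by case: eqP => // _; rewrite ltxx.
Qed.

End TrivialNorm.

(** * The p-adic norm *)

Section PadicNorm.
Variables (K : realType) (p : nat) (A : comPzRingType).
Hypothesis p_gt1 : (1 < p)%N.
Local Notation N := (@padic_norm K p A).
Local Notation q := (p%:R : K).

Lemma ppow_gt0 m : 0 < q ^+ m.
Proof. by rewrite exprn_gt0 // ltr0n ltnW. Qed.

Lemma ppow_inv_gt0 m : 0 < q ^- m.
Proof. by rewrite invr_gt0 ppow_gt0. Qed.

Lemma ppow_ge1 m : 1 <= q ^+ m.
Proof. by rewrite exprn_ege1 // ler1n ltnW. Qed.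

Lemma ppow_inv_le m n : (q ^- m <= q ^- n) = (n <= m)%N.
Proof. by rewrite lef_pV2 ?posrE ?ppow_gt0 // ler_eXn2l // ltr1n. Qed.

Lemma ppow_inv_lt m n : (q ^- m < q ^- n) = (n < m)%N.
Proof. by rewrite ltNge ppow_inv_le -ltnNge. Qed.

Lemma ppow_inv_small (e : K) : 0 < e -> exists m, q ^- m < e.
Proof.
move=> e0; exists (Num.bound e^-1); rewrite invf_plt ?posrE ?ppow_gt0 //.
have: e^-1 < (Num.bound e^-1)%:R by apply: archi_boundP; rewrite invr_ge0 ltW.
move=> /lt_trans; apply; rewrite -natrX ltr_nat; exact: ltn_expl.
Qed.

Lemma ppow_inv_small_fin (I : finType) (e : I -> K) :
  (forall i, 0 < e i) -> exists m, forall i, q ^- m < e i.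
Proof.
move=> e0; have /choice[m mP] i := ppow_inv_small (e0 i).
exists (\max_i m i) => i; apply: le_lt_trans (mP i).
by rewrite ppow_inv_le leq_bigmax.
Qed.

Lemma padic_nonempty a : [set r | exists2 m : nat,
  (exists b : A, a = p%:R ^+ m * b) & r = q ^- m] !=set0.
Proof. by exists (q ^- 0), 0%N => //; exists a; rewrite mul1r. Qed.

Lemma le_padic c a :
  (forall m, congr_mod_pow p m a 0 -> c <= q ^- m) -> c <= N a.
Proof.
move=> H; apply: lb_le_inf; first exact: padic_nonempty.
by move=> r [m [b E] ->]; apply: H; exists b; rewrite subr0.
Qed.

Lemma padic_ge0 a : 0 <= N a.
Proof. by apply: le_padic => m _; apply/ltW/ppow_inv_gt0. Qed.

Lemma padic_le m a : congr_mod_pow p m a 0 -> N a <= q ^- m.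
Proof.
move=> [b]; rewrite subr0 => E; apply: ge_inf.
  by exists 0 => _ [k _ ->]; apply/ltW/ppow_inv_gt0.
by exists m => //; exists b.
Qed.

Lemma padic_lt a c : N a < c -> exists2 m, congr_mod_pow p m a 0 & q ^- m < c.
Proof.
move=> /(inf_lt (padic_nonempty a))[_ [m [b E] ->] lt].
by exists m => //; exists b; rewrite subr0.
Qed.

Lemma padic_lt_ppow a m : N a < q ^- m -> congr_mod_pow p m a 0.
Proof.
move=> /padic_lt[k ak]; rewrite ppow_inv_lt => mk; exact: congr_le (ltnW mk) ak.
Qed.

Lemma padic_seminorm : is_seminorm N.
Proof.
split=> [a||g h]; first exact: padic_ge0.
- apply/le_anti; rewrite padic_ge0 andbT; apply/ler_addgt0Pl => e e0.
  have [m me] := ppow_inv_small e0; rewrite addr0; apply: le_trans (ltW me).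
  by apply: padic_le; apply: congr_refl.
- rewrite leNgt; apply/negP => H.
  have := H; rewrite gt_max => /andP[/padic_lt[k gk kl] /padic_lt[m hm ml]].
  suff : N (g - h) <= q ^- minn k m.
    by rewrite leNgt /minn; case: ifP => _; rewrite ?kl ?ml.
  apply: padic_le; rewrite -[0]subr0; apply: congrD; last apply: congrN.
    exact: congr_le (geq_minl _ _) gk.
  exact: congr_le (geq_minr _ _) hm.
Qed.

(** The bound for given powers of p dividing g and h passes to the infimum first over h, then over
    g. The second passage divides by N h, hence the separate case N h = 0. *)
Lemma padic_submultiplicative : submultiplicative N.
Proof.
split=> [|g h].
  have := @padic_le 0 1; rewrite invr1; apply; exact: congr0.
have H k m : congr_mod_pow p k g 0 -> congr_mod_pow p m h 0 ->
    N (g * h) <= q ^- k * q ^- m.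
  move=> [u Eu] [v Ev]; rewrite -invfM -exprD; apply: padic_le.
  exists (u * v); move: Eu Ev; rewrite !subr0 => -> ->.
  by rewrite mulrACA -exprD.
have H' k : congr_mod_pow p k g 0 -> N (g * h) <= q ^- k * N h.
  move=> gk; rewrite -ler_pdivrMl ?ppow_inv_gt0 //; apply: le_padic => m hm.
  by rewrite ler_pdivrMl ?ppow_inv_gt0 // H.
have [h0|h0] := eqVneq (N h) 0.
  by have := H' 0%N (congr0 _ _ _); rewrite h0 !mulr0.
have h_gt0 : 0 < N h by rewrite lt_neqAle eq_sym h0 padic_ge0.
by rewrite -ler_pdivrMr //; apply: le_padic => m gm; rewrite ler_pdivrMr // H'.
Qed.

Lemma padic_is_completion :
  (forall a : A, (forall n, congr_mod_pow p n a 0) -> a = 0) ->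
  (forall u : nat -> A, (forall n, congr_mod_pow p n (u n.+1) (u n)) ->
     exists l, forall n, congr_mod_pow p n l (u n)) ->
  is_completion N N idfun.
Proof.
move=> sep compl; apply: completion_of_complete.
- split; [exact: padic_seminorm|move=> a a0; apply: sep => n].
  by apply: padic_lt_ppow; rewrite a0 ppow_inv_gt0.
- exact: padic_submultiplicative.
move=> u uC; have /choice[M MP] n : exists M, forall k m,
    (M <= k)%N -> (M <= m)%N -> congr_mod_pow p n (u k) (u m).
  have [M MP] := uC _ (ppow_inv_gt0 n); exists M => k m Mk Mm.
  by apply/congr_subr0/padic_lt_ppow/MP.
(* From rank M n on, u is constant modulo p^n. Since [compl] asks for step n to be a multiple of
   p^n, it is applied to the subsequence at these ranks. *)
have [|l lP] := compl (u \o M).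
  move=> n; apply: (@congr_trans _ _ _ (u (M n + M n.+1)%N)).
    by apply: congr_le (MP n.+1 _ _ _ _) => //; rewrite leq_addl.
  by apply: MP => //; rewrite leq_addr.
exists l => e e0; have [n ne] := ppow_inv_small e0; exists (M n) => m Mm.
apply: le_lt_trans ne; apply: padic_le; apply/congr_subr0.
by apply: congr_trans (congr_sym (lP n)); apply: MP.
Qed.

End PadicNorm.
(** * Teichmüller representatives and digits *)

Section WittRings.
Variables (p : nat) (R W : comPzRingType) (pi : {rmorphism W -> R}).
Hypotheses (p_prime : prime p) (R_Fp_algebra : p%:R = 0 :> R).
Hypotheses (R_perfect : bijective (fun x : R => x ^+ p)).
Hypothesis W_witt : is_witt_ring p pi.
Local Notation cg := (@congr_mod_pow p W).
Local Notation T := (teichmuller p pi).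

Lemma pi_eq (w w' : W) : pi w = pi w' <-> cg 1 w w'.
Proof.
rewrite -congr_subr0 -(witt_pi_ker W_witt) rmorphB.
by split=> [->|/eqP]; [rewrite subrr|rewrite subr_eq0 => /eqP].
Qed.

Lemma pi_p (w : W) : pi (p%:R * w) = 0.
Proof. by rewrite rmorphM rmorph_nat R_Fp_algebra mul0r. Qed.

Lemma pmul_inj (w w' : W) : p%:R * w = p%:R * w' -> w = w'.
Proof.
move=> E; apply/eqP; rewrite -subr_eq0; apply/eqP/(witt_torsion_free W_witt).
by rewrite mulrBr E subrr.
Qed.

Lemma congr_pdiv n (w w' : W) : cg n.+1 (p%:R * w) (p%:R * w') -> cg n w w'.
Proof.
by move=> [z]; rewrite -mulrBr exprS -mulrA => /pmul_inj E; exists z.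
Qed.

Lemma congr_eq (w w' : W) : (forall n, cg n w w') -> w = w'.
Proof.
move=> E; apply/eqP; rewrite -subr_eq0; apply/eqP/(witt_separated W_witt) => n.
exact/congr_subr0.
Qed.

(** The cofactor of w - w' in w^p - w'^p is a sum of p terms that are all equal modulo p, hence it
    is divisible by p. *)
Lemma congr_frob n (w w' : W) : cg n.+1 w w' -> cg n.+2 (w ^+ p) (w' ^+ p).
Proof.
move=> E; have Epi : pi w = pi w' by apply/pi_eq; apply: congr_le E.
have : pi (\sum_(i < p) w ^+ (p.-1 - i) * w' ^+ i) = 0.
  rewrite rmorph_sum /= (eq_bigr (fun=> pi w ^+ p.-1)) => [|i _].
    by rewrite sumr_const card_ord -mulr_natl R_Fp_algebra mul0r.
  rewrite rmorphM !rmorphXn /= -Epi -exprD subnK //.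
  by case: p i => [[]|k i] //; rewrite -ltnS.
move/(witt_pi_ker W_witt) => [v]; rewrite subr0 => Ev.
case: E => u Eu; exists (u * v).
by rewrite subrXX Ev Eu expr1 [in RHS]exprSr -!mulrA (mulrCA u).
Qed.

Lemma congr_frob_iter n (w w' : W) :
  pi w = pi w' -> cg n.+1 (w ^+ (p ^ n)) (w' ^+ (p ^ n)).
Proof.
move=> /pi_eq E; elim: n => [|n IH]; first by rewrite !expr1.
by rewrite expnSr !exprM; apply: congr_frob.
Qed.

Lemma frob_iter_inj n (x y : R) : x ^+ (p ^ n) = y ^+ (p ^ n) -> x = y.
Proof.
by elim: n => [|n IH]; rewrite ?expr1 // expnSr !exprM => /(bij_inj R_perfect).
Qed.

Lemma frob_iter_surj n (x : R) : exists y : R, y ^+ (p ^ n) = x.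
Proof.
elim: n x => [|n IH] x; first by exists x; rewrite expr1.
case: R_perfect => g _ gK; have [y Ey] := IH (g x).
by exists y; rewrite expnSr exprM Ey gK.
Qed.

(** One power of p is gained over [witt_complete], by comparing the limit with the next term of
    u. *)
Lemma congr_limit (u : nat -> W) :
  (forall n, cg n.+1 (u n.+1) (u n)) -> exists l, forall n, cg n.+1 l (u n).
Proof.
move=> uP; have [|l lP] := witt_complete W_witt (u := u).
  by move=> n; apply: congr_le (uP n).
exists l => n; apply: congr_trans (lP n.+1) (uP n).
Qed.

(* A p^n-th power only depends on its base modulo p, up to p^(n+1); this is
   what pins down the limit of the p^n-th powers of lifts of x^(1/p^n). *)
Lemma teichmuller_ex (x : R) : exists t : W, forall n w,
  pi w ^+ (p ^ n) = x -> cg n.+1 t (w ^+ (p ^ n)).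
Proof.
have /choice[u uP] : forall n, exists w : W, pi w ^+ (p ^ n) = x.
  move=> n; have [y Ey] := frob_iter_surj n x.
  by have [w Ew] := witt_pi_surj W_witt y; exists w; rewrite Ew.
have [n|t tP] := @congr_limit (fun n => u n ^+ (p ^ n)).
  rewrite expnS exprM; apply: congr_frob_iter; apply: (@frob_iter_inj n).
  by rewrite rmorphXn -exprM -expnS !uP.
exists t => n w Ew; apply: congr_trans (tP n) _; apply: congr_frob_iter.
by apply: (@frob_iter_inj n); rewrite uP.
Qed.

(** Since [teichmuller] is picked by [xget], it must be identified with the limit t of
    [teichmuller_ex]. That t lifts x and has all p^n-th roots makes the defining set nonempty; any
    element of that set is congruent to t modulo every p^n. *)
Lemma teichmuller_congr (x : R) n w :
  pi w ^+ (p ^ n) = x -> cg n.+1 (T x) (w ^+ (p ^ n)).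
Proof.
move: n w; have [t tP] := teichmuller_ex x.
suff -> : T x = t by [].
(* The limit s attached to a p^m-th root y of x is a p^m-th root of t. *)
have tX m y s : (forall n w, pi w ^+ (p ^ n) = y -> cg n.+1 s (w ^+ (p ^ n))) ->
    y ^+ (p ^ m) = x -> s ^+ (p ^ m) = t.
  move=> sP Ey; apply: congr_eq => n; have [z Ez] := frob_iter_surj n y.
  have [w Ew] := witt_pi_surj W_witt z.
  apply: (@congr_trans _ _ _ ((w ^+ (p ^ m)) ^+ (p ^ n))).
    rewrite exprAC; apply: congrX; apply: congr_le (sP n w _) => //.
    by rewrite Ew.
  apply: congr_sym; apply: congr_le (tP n _ _) => //.
  by rewrite rmorphXn exprAC Ew Ez.
have [] : pi (T x) = x /\ (forall n : nat, exists v, v ^+ (p ^ n)%N = T x).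
  apply: (@xgetPex _ 0
    [set w | pi w = x /\ forall n, exists v, v ^+ (p ^ n)%N = w]).
  exists t; split=> [|n].
    have [w Ew] := witt_pi_surj W_witt x.
    by rewrite -Ew; apply/pi_eq; have := tP 0%N w; rewrite !expr1; apply.
  have [y Ey] := frob_iter_surj n x; have [s sP] := teichmuller_ex y.
  by exists s; apply: tX Ey.
move=> Ex rT; apply: congr_eq => n; have [v Ev] := rT n.
rewrite -Ev; apply: congr_sym; apply: congr_le (tP n v _) => //.
by rewrite -rmorphXn Ev.
Qed.

Lemma pi_teichmuller x : pi (T x) = x.
Proof.
have [w Ew] := witt_pi_surj W_witt x.
rewrite -{2}Ew; apply/pi_eq; have := @teichmuller_congr x 0 w.
by rewrite !expr1; apply.
Qed.

(** This criterion yields the multiplicativity of T and its values at 0 and 1: it is enough to test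
    t against one convenient lift of the p^n-th root of x for each n. *)
Lemma teichmuller_unique x t :
  (forall n, exists2 w, pi w ^+ (p ^ n) = x & cg n t (w ^+ (p ^ n))) -> T x = t.
Proof.
move=> tP; apply: congr_eq => n; have [w Ew E] := tP n.
by apply: congr_trans (congr_sym E); apply: congr_le (teichmuller_congr Ew).
Qed.

Lemma teichmullerM x y : T (x * y) = T x * T y.
Proof.
apply: teichmuller_unique => n.
have [[a Ea] [b Eb]] := (frob_iter_surj n x, frob_iter_surj n y).
exists (T a * T b); first by rewrite rmorphM !pi_teichmuller exprMn Ea Eb.
rewrite exprMn; apply: congrM; apply: congr_le (teichmuller_congr _) => //;
by rewrite pi_teichmuller.
Qed.

Lemma teichmuller1 : T 1 = 1.
Proof.
apply: teichmuller_unique => n; exists 1; rewrite ?rmorph1 !expr1n //.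
exact: congr_refl.
Qed.

Lemma teichmuller0 : T 0 = 0.
Proof.
apply: teichmuller_unique => n.
have p0 : (0 < p ^ n)%N by rewrite expn_gt0 prime_gt0.
exists 0; rewrite ?rmorph0 !expr0n (gtn_eqF p0) //; exact: congr_refl.
Qed.

Lemma teichmullerX x n : T (x ^+ n) = T x ^+ n.
Proof.
by elim: n => [|n IH]; rewrite ?teichmuller1 // !exprS teichmullerM IH.
Qed.

(** * Digits and truncated expansions *)

Lemma shift_ex (w : W) : exists u, w = T (pi w) + p%:R * u.
Proof.
have /pi_eq[u] : pi w = pi (T (pi w)) by rewrite pi_teichmuller.
by rewrite expr1 => E; exists u; rewrite -E addrC subrK.
Qed.

(** This is (w - [pi w]) / p, unambiguous because W has no p-torsion. Iterating it strips the digits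
    of w one at a time. *)
Definition witt_shift (w : W) : W := sval (cid (shift_ex w)).
Definition digit (w : W) (i : nat) : R := pi (iter i witt_shift w).

Lemma witt_shiftE w : w = T (pi w) + p%:R * witt_shift w.
Proof. exact: svalP (cid (shift_ex w)). Qed.

Lemma digitS w i : digit w i.+1 = digit (witt_shift w) i.
Proof. by rewrite /digit iterSr. Qed.

(** Once the equal leading representatives are subtracted, cancelling p leaves the two tails
    congruent modulo one power less, and induction applies. *)
Lemma digit_congr n w w' : cg n w w' ->
  forall i, (i < n)%N -> digit w i = digit w' i.
Proof.
elim: n w w' => // n IH w w' E.
have E0 : pi w = pi w' by apply/pi_eq; apply: congr_le E.
have ES : cg n (witt_shift w) (witt_shift w').
  apply: congr_pdiv; case: E => z.
    rewrite {1}(witt_shiftE w) {1}(witt_shiftE w').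
  by rewrite E0 opprD addrACA subrr add0r => E; exists z.
by case=> [|i] // lti; rewrite !digitS; apply: IH ES _ _.
Qed.

Definition wsum n (x : nat -> R) : W := \sum_(i < n) p%:R ^+ i * T (x i).

Lemma wsumS n x : wsum n.+1 x = T (x 0%N) + p%:R * wsum n (x \o S).
Proof.
rewrite /wsum big_ord_recl expr0 mul1r mulr_sumr; congr (_ + _).
by apply: eq_bigr => i _; rewrite exprS mulrA.
Qed.

Lemma digit_TD x u : pi (T x + p%:R * u) = x /\ witt_shift (T x + p%:R * u) = u.
Proof.
have E : pi (T x + p%:R * u) = x by rewrite rmorphD pi_p addr0 pi_teichmuller.
split=> //; have := witt_shiftE (T x + p%:R * u).
by rewrite E => /addrI/pmul_inj.
Qed.

Lemma wsum_iter n w :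
  w = wsum n (digit w) + p%:R ^+ n * iter n witt_shift w.
Proof.
elim: n w => [|n IH] w; first by rewrite /wsum big_ord0 add0r mul1r.
rewrite wsumS {1}(witt_shiftE w) {1}(IH (witt_shift w)) mulrDr addrA.
rewrite exprS mulrA -iterSr; congr (_ + _ * _ + _).
by apply: eq_bigr => i _; rewrite -digitS.
Qed.

Lemma teichmuller_expansion_digit w : teichmuller_expansion p pi w (digit w).
Proof.
move=> n; exists (iter n witt_shift w).
by rewrite {1}(wsum_iter n w) addrC addKr.
Qed.

Lemma digit_pmul w i :
  digit (p%:R * w) i = if i is i'.+1 then digit w i' else 0.
Proof.
have E : p%:R * w = T 0 + p%:R * w by rewrite teichmuller0 add0r.
case: i => [|i]; rewrite E ?digitS ?(digit_TD _ _).2 //.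
by rewrite /digit (digit_TD _ _).1.
Qed.

Lemma digit_ppow_mul k w i : 
  digit (p%:R ^+ k * w) i = if (i < k)%N then 0 else digit w (i - k).
Proof.
elim: k i => [|k IH] i; first by rewrite mul1r subn0.
by rewrite exprS -mulrA digit_pmul; case: i => // i; rewrite IH.
Qed.

Lemma digit0 i : digit 0 i = 0.
Proof. by rewrite -(mulr0 (p%:R ^+ i.+1)) digit_ppow_mul ltnSn. Qed.

Lemma digitT x i : digit (T x) i = if i is 0 then x else 0.
Proof.
have -> : T x = T x + p%:R * (p%:R ^+ i * 0) by rewrite !mulr0 addr0.
case: i => [|i]; first by rewrite /digit (digit_TD _ _).1.
rewrite digitS (digit_TD _ _).2 digit_ppow_mul ltnSn //.
Qed.

Lemma digit_wsum n x i : digit (wsum n x) i = if (i < n)%N then x i else 0.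
Proof.
elim: n x i => [|n IH] x i.
  by rewrite /wsum big_ord0 digit0.
rewrite wsumS; case: i => [|i]; first by rewrite /digit /= (digit_TD _ _).1.
by rewrite digitS (digit_TD _ _).2 IH.
Qed.

Lemma teichmuller_expansion_unique w x :
  teichmuller_expansion p pi w x -> x = digit w.
Proof.
move=> wx; apply/funext => i.
by rewrite (digit_congr (wx i.+1) (ltnSn i)) digit_wsum ltnSn.
Qed.

(** The inverse is the p-adic limit of the geometric series of - p w. It will correct a unit ideal
    relation lifted from R to W. *)
Lemma unit_one_add_pmul (w : W) : exists v, (1 + p%:R * w) * v = 1.
Proof.
pose q := - (p%:R * w); pose u n := \sum_(i < n) q ^+ i.
have qX n : cg n (q ^+ n) 0.
  by rewrite /q -mulrN exprMn; apply: congr_pow_mul.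
have [|l lP] := witt_complete W_witt (u := u).
  move=> n; rewrite /u big_ord_recr /= -{2}[\sum_(i < n) _]addr0.
  by apply: congrD; [exact: congr_refl|exact: qX].
exists l; apply: congr_eq => n.
apply: congr_trans (congrM (congr_refl _ n _) (lP n)) _.
have -> : (1 + p%:R * w) * u n = 1 - q ^+ n.
  have -> : 1 + p%:R * w = 1 - q by rewrite opprK.
  have := subrXX 1 q n; rewrite expr1n => ->; congr (_ * _).
  by apply: eq_bigr => i _; rewrite expr1n mul1r.
rewrite -{2}[1]subr0; apply: congrD (congrN (qX n)); exact: congr_refl.
Qed.

(** * The maps lambda and mu *)

Section Lambda.
Variable K : realType.
Local Notation q := (p%:R : K).
Local Notation spectrum_R := (gelfand (@trivial_norm K R)).
Let p_gt1 : (1 < p)%N := prime_gt1 p_prime.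

(** * The seminorm on W attached to a fixed alpha *)

Section FixedSeminorm.
Variable alpha : spectrum_R.
Local Notation a := (val alpha).

Lemma spectrum_le1 x : a x <= 1.
Proof. exact: le_trans (gelfand_bound _ _) (trivial_norm_le1 _ _). Qed.

(** The condition lambda(alpha)(w) <= c, seen modulo p^n. The bound c stays free because passing to
    the tail of w multiplies it by p. *)
Definition digits_le (c : K) (n : nat) (w : W) : Prop :=
  forall i, (i < n)%N -> a (digit w i) <= c * q ^+ i.

Lemma digits_leS c n w :
  digits_le c n.+1 w <-> a (pi w) <= c /\ digits_le (c * q) n (witt_shift w).
Proof.
split=> [H|[H0 H] [_|i lti]]; last by rewrite digitS exprS mulrA H.
  split=> [|i lti]; first by have := H 0%N isT; rewrite mulr1.
  by have := H i.+1 lti; rewrite digitS exprS mulrA.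
by rewrite mulr1.
Qed.

Lemma digits_le_congr c n w w' :
  cg n w w' -> digits_le c n w -> digits_le c n w'.
Proof. by move=> E H i lti; rewrite -(digit_congr E lti) H. Qed.

Lemma digits_le_ppowT c n k x : 0 <= c -> a x <= c * q ^+ k ->
  digits_le c n (p%:R ^+ k * T x).
Proof.
move=> c0 xc i _; rewrite digit_ppow_mul digitT.
have c0' : 0 <= c * q ^+ i by rewrite mulr_ge0 // ltW // ppow_gt0.
case: ltnP => ki; first by rewrite gelfand_0.
case E: (i - k)%N => [|j]; last by rewrite gelfand_0.
have -> // : i = k; by apply/eqP; rewrite eqn_leq ki -subn_eq0 E.
Qed.

(** Replacing the smaller of a(u) and a(v) by the larger turns the monomial into a pure n-th power.
    Both exponents are positive, as [gelfandXS] requires. *)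
Lemma root_le n c u v k : (0 < k < n)%N ->
  a (u ^+ n) <= c -> a (v ^+ n) <= c -> a (u ^+ (n - k) * v ^+ k) <= c.
Proof.
case: k => // k /andP[_ kn].
have [m Em] : exists m, (n - k.+1)%N = m.+1.
  by exists (n - k.+1).-1; rewrite prednK // subn_gt0.
have -> : n = (m.+1 + k.+1)%N by rewrite -Em subnK // ltnW.
rewrite addnK gelfandM !addSn !gelfandXS => uc vc.
have [uv|vu] := leP (a u) (a v).
  apply: le_trans vc; rewrite -addSn exprD ler_wpM2r ?exprn_ge0 ?gelfand_ge0 //.
  by rewrite lerXn2r ?nnegrE ?gelfand_ge0.
apply: le_trans uc; rewrite -addSn exprD ler_wpM2l ?exprn_ge0 ?gelfand_ge0 //.
by rewrite lerXn2r ?nnegrE ?gelfand_ge0 // ltW.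
Qed.

(* Modulo p^(n+1), [x + y] is the p^n-th power of [x^(1/p^n)] + [y^(1/p^n)],
   whose binomial expansion only involves Teichmüller representatives of
   monomials of total degree 1 in x and y. *)
Lemma shift_TD n c x y : a x <= c -> a y <= c ->
  exists (m : nat) (e : 'I_m -> nat) (z : 'I_m -> R),
    (forall k, a (z k) <= c) /\
    cg n (witt_shift (T x + T y)) (\sum_k (e k)%:R * T (z k)).
Proof.
move=> xc yc; have [[u Eu] [v Ev]] := (frob_iter_surj n x, frob_iter_surj n y).
pose m := (p ^ n)%N; pose z (k : 'I_m.-1) := u ^+ (m - k.+1) * v ^+ k.+1.
(* The carry is - S modulo p^n. As - 1 is congruent to p^n - 1, the sign is absorbed in the factor
   [m.-1], which keeps the coefficients natural numbers. *)
exists m.-1, (fun k => ('C(m, k.+1) %/ p) * m.-1)%N, z; split=> [k|].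
  apply: root_le; rewrite ?Eu ?Ev //= -ltn_predRL //.
pose S := \sum_(k < m.-1) ('C(m, k.+1) %/ p)%:R * T (z k).
have E1 : cg n.+1 (T (x + y)) (T x + T y + p%:R * S).
  have Exy : pi (T u + T v) ^+ (p ^ n) = x + y.
    rewrite rmorphD !pi_teichmuller exprD_ppow // R_Fp_algebra mul0r addr0.
    by rewrite Eu Ev.
  apply: congr_trans (teichmuller_congr Exy) _.
  rewrite exprD_ppow // -!teichmullerX Eu Ev; apply: congrD.
    exact: congr_refl.
  rewrite /S; under eq_bigr do rewrite -!teichmullerX -teichmullerM.
  exact: congr_refl.
have E2 : cg n (witt_shift (T x + T y)) (- S).
  apply: congr_pdiv; have := witt_shiftE (T x + T y).
  rewrite rmorphD !pi_teichmuller => E.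
  have -> : p%:R * witt_shift (T x + T y) = T x + T y - T (x + y).
    by rewrite {2}E [RHS]addrC addKr.
  apply: (@congr_trans _ _ _ (T x + T y - (T x + T y + p%:R * S))).
    by apply: congrD; [exact: congr_refl|exact: congrN].
  by rewrite opprD addrA subrr add0r mulrN; apply: congr_refl.
apply: congr_trans E2 _.
have -> : \sum_(k < m.-1) ('C(m, k.+1) %/ p * m.-1)%:R * T (z k) = m.-1%:R * S.
  rewrite mulr_sumr; apply: eq_bigr => k _.
  by rewrite natrM mulrA [_ * m.-1%:R]mulrC.
exists (- S); rewrite -natrX -/m.
have -> : m%:R = m.-1%:R + 1 :> W.
  by rewrite natr1 prednK // expn_gt0 prime_gt0.
by rewrite mulrN mulrDl mul1r opprD addrC.
Qed.

(** Closure under addition is a hypothesis because the lemma is used inside the induction that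
    proves it. *)
Lemma digits_le_ind c n : 0 <= c ->
  (forall w w', digits_le c n w -> digits_le c n w' ->
     digits_le c n (w + w')) ->
  forall (I : finType) (e : I -> nat) (f : I -> W),
  (forall i, digits_le c n (f i)) -> digits_le c n (\sum_i (e i)%:R * f i).
Proof.
move=> c0 add I e f H.
have H0 : digits_le c n 0.
  move=> i _; rewrite digit0 gelfand_0.
  by rewrite mulr_ge0 // ltW // ppow_gt0.
apply: (big_ind (digits_le c n)) => // i _; elim: (e i) => [|k IH].
  by rewrite mul0r.
by rewrite -natr1 mulrDl mul1r; apply: add.
Qed.

(** The tail of w + w' is the sum of the two tails and of the carry of [pi w] + [pi w']. By
    [shift_TD] the carry is bounded by c, hence by the bound c q valid for the tails, and the
    induction hypothesis at c q adds the three. *)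
Lemma digits_leD c n w w' : 0 <= c ->
  digits_le c n w -> digits_le c n w' -> digits_le c n (w + w').
Proof.
elim: n c w w' => [|n IH] c w w' c0; first by move=> _ _ i.
move=> /digits_leS[w0 wS] /digits_leS[w0' wS'].
have cq0 : 0 <= c * q by rewrite mulr_ge0.
have ccq : c <= c * q by rewrite ler_peMr // ler1n ltnW.
have -> : w + w' = T (pi w + pi w') + p%:R * (witt_shift (T (pi w) + T (pi w'))
    + (witt_shift w + witt_shift w')).
  have := witt_shiftE (T (pi w) + T (pi w')).
  rewrite rmorphD !pi_teichmuller => E.
  by rewrite mulrDr addrA -E mulrDr addrACA -!witt_shiftE.
apply/digits_leS; rewrite (digit_TD _ _).1 (digit_TD _ _).2; split.
  by apply: le_trans (seminormD (gelfand_seminorm _) _ _) _; rewrite ge_max w0.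
apply: (IH) => //; last exact: IH.
have [m [e [z [zc E]]]] := shift_TD n w0 w0'.
apply: digits_le_congr (congr_sym E) _; apply: digits_le_ind => // [u v|k].
  exact: IH.
rewrite -[T _]mul1r; apply: (@digits_le_ppowT _ _ 0) => //.
by rewrite mulr1 (le_trans (zc k)).
Qed.

Lemma digits_le_sum c n (I : finType) (e : I -> nat) (f : I -> W) : 0 <= c ->
  (forall i, digits_le c n (f i)) -> digits_le c n (\sum_i (e i)%:R * f i).
Proof. by move=> c0; apply: digits_le_ind => // w w'; apply: digits_leD. Qed.

(** Modulo p^n, - w equals (p^n - 1) w, so closure under sums is enough. *)
Lemma digits_leN c n w : 0 <= c -> digits_le c n w -> digits_le c n (- w).
Proof.
move=> c0 H; apply: (@digits_le_congr _ _ (\sum_(i < 1) (p ^ n).-1%:R * w)).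
  exists w; rewrite big_ord1 opprK -{2}[w]mul1r -mulrDl.
  by rewrite natr1 prednK ?natrX // expn_gt0 prime_gt0.
exact: digits_le_sum.
Qed.

(** Multiplying the truncated expansions gives a sum of terms p^(i+j) [x_i y_j], each of which
    satisfies the bound c c'. *)
Lemma digits_leM c c' n w w' : 0 <= c -> 0 <= c' ->
  digits_le c n w -> digits_le c' n w' -> digits_le (c * c') n (w * w').
Proof.
move=> c0 c0' H H'; have cc0 : 0 <= c * c' by rewrite mulr_ge0.
have E := congrM (teichmuller_expansion_digit w n)
  (teichmuller_expansion_digit w' n).
apply: digits_le_congr (congr_sym E) _; rewrite big_distrlr /=.
have -> : \sum_(i < n) \sum_(j < n)
      p%:R ^+ i * T (digit w i) * (p%:R ^+ j * T (digit w' j))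
    = \sum_(i < n) 1%:R * \sum_(j < n)
        1%:R * (p%:R ^+ (i + j) * T (digit w i * digit w' j)).
  apply: eq_bigr => i _; rewrite mul1r; apply: eq_bigr => j _.
  by rewrite mul1r mulrACA -exprD -teichmullerM.
apply: digits_le_sum => // i; apply: digits_le_sum => // j.
apply: digits_le_ppowT => //; rewrite gelfandM exprD mulrACA.
by apply: ler_pM; rewrite ?gelfand_ge0 ?H ?H'.
Qed.

Definition lambda_fun (w : W) : K :=
  sup (range (fun i : nat => q ^- i * a (digit w i))).

Lemma lambda_term_le1 w i : q ^- i * a (digit w i) <= q ^- i.
Proof. by rewrite ler_piMr ?spectrum_le1 // ltW // ppow_inv_gt0. Qed.

Lemma lambda_term_ubound w :
  ubound (range (fun i : nat => q ^- i * a (digit w i))) 1.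
Proof.
move=> _ [i _ <-]; apply: le_trans (lambda_term_le1 w i) _.
by have := ppow_inv_le K p_gt1 i 0; rewrite invr1 => ->.
Qed.

Lemma lambda_ge w i : q ^- i * a (digit w i) <= lambda_fun w.
Proof.
apply: sup_upper_bound; last by exists i.
split; first by exists (q ^- 0 * a (digit w 0)), 0%N.
by exists 1; apply: lambda_term_ubound.
Qed.

Lemma lambda_le c w : lambda_fun w <= c <-> (forall n, digits_le c n w).
Proof.
split=> [H n i _|H].
  by rewrite -ler_pdivrMr ?ppow_gt0 // mulrC (le_trans (lambda_ge w i)).
apply: ge_sup; first by exists (q ^- 0 * a (digit w 0)), 0%N.
by move=> _ [i _ <-]; rewrite mulrC ler_pdivrMr ?ppow_gt0 // (H i.+1).
Qed.

Lemma lambda_ge0 w : 0 <= lambda_fun w.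
Proof.
by apply: le_trans (lambda_ge w 0); rewrite mulr_ge0 ?gelfand_ge0.
Qed.

Lemma lambda_attained w : exists i, lambda_fun w = q ^- i * a (digit w i).
Proof.
have [E|/existsNP[i0 /eqP i0P]] := pselect (forall i, a (digit w i) = 0).
  exists 0%N; apply/le_anti; rewrite lambda_ge andbT E mulr0.
  by apply/lambda_le => n i _; rewrite E mul0r.
pose v i := q ^- i * a (digit w i).
have v0 : 0 < v i0.
  by rewrite mulr_gt0 ?ppow_inv_gt0 // lt_neqAle eq_sym i0P gelfand_ge0.
(* Terms from N on are at most q^-N, which is below the positive term v i0, so the supremum is the
   maximum of the first N terms. *)
have [N vN] := ppow_inv_small p_gt1 v0.
have i0N : (i0 < N)%N.
  rewrite -(ppow_inv_lt K p_gt1); exact: lt_le_trans vN (lambda_term_le1 w i0).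
case: (@Order.TotalTheory.arg_maxP _ _ _ (Ordinal i0N) xpredT
  (fun i => v i) isT).
move=> i _ imax; exists i; apply/le_anti; rewrite lambda_ge andbT.
apply: ge_sup; first by exists (q ^- 0 * a (digit w 0)), 0%N.
move=> _ [j _ <-]; have [jN|Nj] := ltnP j N; first exact: (imax (Ordinal jN)).
apply: le_trans (imax (Ordinal i0N) isT); apply: le_trans (ltW vN).
by apply: le_trans (lambda_term_le1 w j) _; rewrite ppow_inv_le.
Qed.

Lemma lambda_first_attained w : exists2 i, lambda_fun w = q ^- i * a (digit w i)
  & forall j, (j < i)%N -> q ^- j * a (digit w j) < lambda_fun w.
Proof.
have ex : exists i, lambda_fun w == q ^- i * a (digit w i).
  by have [i E] := lambda_attained w; exists i; apply/eqP.
case: (ex_minnP ex) => i /eqP E imin; exists i => // j; rewrite ltnNge => ji.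
by rewrite lt_neqAle lambda_ge andbT eq_sym; apply: contra ji; apply: imin.
Qed.

Lemma lambda_seminorm : is_seminorm lambda_fun.
Proof.
split=> [w||w w']; first exact: lambda_ge0.
  apply/le_anti; rewrite lambda_ge0 andbT; apply/lambda_le => n i _.
  by rewrite digit0 gelfand_0 mul0r.
have c0 : 0 <= Num.max (lambda_fun w) (lambda_fun w').
  by rewrite le_max lambda_ge0.
apply/lambda_le => n; apply: digits_leD => //; last apply: digits_leN => //.
  by move: n; apply/lambda_le; rewrite le_max lexx.
by move: n; apply/lambda_le; rewrite le_max lexx orbT.
Qed.

Lemma lambdaM_le w w' : lambda_fun (w * w') <= lambda_fun w * lambda_fun w'.
Proof.
apply/lambda_le => n; apply: digits_leM; rewrite ?lambda_ge0 //;
  by move: n; apply/lambda_le.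
Qed.

(** Cutting the expansion just before its first digit of maximal weight leaves only smaller terms in
    h and makes that digit the leading one of t. *)
Lemma lambda_split w : 0 < lambda_fun w -> exists i (h t : W),
  [/\ w = h + p%:R ^+ i * t, lambda_fun h < lambda_fun w
    & lambda_fun w = q ^- i * a (pi t)].
Proof.
move=> w0; have [i E imin] := lambda_first_attained w.
exists i, (wsum i (digit w)), (iter i witt_shift w).
split=> //; first exact: wsum_iter.
have [j ->] := lambda_attained (wsum i (digit w)).
by rewrite digit_wsum; case: ltnP => [/imin //|_]; rewrite gelfand_0 mulr0.
Qed.

(* The terms before the first maximal one in each factor contribute strictly
   less than lambda(w) lambda(w'), and the leading digit of the product of the
   remaining tails is the product of the two maximal digits. *)
Lemma lambdaM w w' : lambda_fun (w * w') = lambda_fun w * lambda_fun w'.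
Proof.
apply/le_anti; rewrite lambdaM_le /=; have LS := lambda_seminorm.
have [->|w0] := eqVneq (lambda_fun w) 0; first by rewrite mul0r lambda_ge0.
have {}w0 : 0 < lambda_fun w by rewrite lt_neqAle eq_sym w0 lambda_ge0.
have [->|w0'] := eqVneq (lambda_fun w') 0; first by rewrite mulr0 lambda_ge0.
have {}w0' : 0 < lambda_fun w' by rewrite lt_neqAle eq_sym w0' lambda_ge0.
have [i [h [t [Ew hlt Lw]]]] := lambda_split w0.
have [j [h' [t' [Ew' hlt' Lw']]]] := lambda_split w0'.
pose X := h * w'; pose Y := p%:R ^+ i * t * h'.
pose Z := p%:R ^+ (i + j) * (t * t').
have EZ : Z = w * w' - (X + Y).
  rewrite /X {1}Ew mulrDl opprD addrACA subrr add0r /Y {1}Ew' mulrDr.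
  by rewrite [RHS]addrC addKr mulrACA -exprD.
have Xlt : lambda_fun X < lambda_fun w * lambda_fun w'.
  by apply: le_lt_trans (lambdaM_le _ _) _; rewrite ltr_pM2r.
have Ylt : lambda_fun Y < lambda_fun w * lambda_fun w'.
  apply: le_lt_trans (lambdaM_le _ _) _.
  apply: (@le_lt_trans _ _ (lambda_fun w * lambda_fun h')).
    rewrite ler_wpM2r ?lambda_ge0 //.
    have -> : p%:R ^+ i * t = w - h by rewrite {1}Ew addrC addKr.
    by apply: le_trans (seminormB LS _ _) _; rewrite ge_max lexx ltW.
  by rewrite ltr_pM2l.
have Zge : lambda_fun w * lambda_fun w' <= lambda_fun Z.
  apply: le_trans (lambda_ge Z (i + j)).
  rewrite /Z digit_ppow_mul ltnn subnn /digit /= rmorphM gelfandM Lw Lw'.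
  by rewrite exprD invfM mulrACA.
have XYlt : lambda_fun (X + Y) < lambda_fun w * lambda_fun w'.
  by apply: le_lt_trans (seminormD LS X Y) _; rewrite gt_max Xlt.
move: Zge; rewrite EZ => /le_trans/(_ (seminormB LS _ _)).
rewrite le_max => /orP[//|].
by rewrite leNgt XYlt.
Qed.

Lemma lambda_le_padic w : lambda_fun w <= padic_norm K p w.
Proof.
apply: le_padic => m [z]; rewrite subr0 => ->; apply/lambda_le => n i _.
rewrite digit_ppow_mul; case: ltnP => mi.
  by rewrite gelfand_0 mulr_ge0 // ltW // ?ppow_inv_gt0 ?ppow_gt0.
apply: le_trans (spectrum_le1 _) _.
by rewrite mulrC ler_pdivlMr ?ppow_gt0 // mul1r ler_eXn2l // ltr1n.
Qed.

Lemma lambda_gelfand : gelfand (@padic_norm K p W) lambda_fun.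
Proof.
split; [exact: lambda_seminorm| |exact: lambda_le_padic].
split; last exact: lambdaM.
apply: le_trans (lambda_le_padic 1) _.
by case: (@padic_submultiplicative K p W p_gt1).
Qed.

End FixedSeminorm.

(** * The maps between the spectra and their composites *)

Local Notation spectrum_W := (gelfand (@padic_norm K p W)).

Definition lambda (alpha : spectrum_R) : spectrum_W :=
  exist _ (lambda_fun alpha : {ptws W -> K}) (mem_set (lambda_gelfand alpha)).

(** Estimates modulo p^n carry an error of size at most p^-n, which is discarded here by letting n
    grow. *)
Lemma le_max_ppow_inv (c x : K) :
  0 <= c -> (forall n, x <= Num.max c (q ^- n)) -> x <= c.
Proof.
move=> c0 H; rewrite leNgt; apply/negP => cx.
have [n nx] := ppow_inv_small p_gt1 (le_lt_trans c0 cx).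
by have := H n; rewrite leNgt gt_max cx nx.
Qed.

Lemma spectrum_ppow_le (beta : spectrum_W) n w :
  val beta (p%:R ^+ n * w) <= q ^- n.
Proof.
apply: le_trans (gelfand_bound _ _) _; apply: padic_le => //.
exact: congr_pow_mul.
Qed.

(** The ultrametric inequality is the point. Modulo p^n, [x + y] is the p^n-th power of [x^(1/p^n)]
    + [y^(1/p^n)]; beta is ultrametric on this sum, and multiplicativity turns the p^n-th powers
    back into values at [x] and [y]. *)
Lemma mu_gelfand (beta : spectrum_W) :
  gelfand (@trivial_norm K R) (fun x => val beta (T x)).
Proof.
have bS := gelfand_seminorm beta.
(* Comparing squares treats odd p and p = 2 alike. *)
have bN y : val beta (T (- y)) = val beta (T y).
  apply/eqP; rewrite -(@eqrXn2 _ 2) ?gelfand_ge0 //.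
  by rewrite -!gelfandXS -!teichmullerX sqrrN.
have bD x y : val beta (T (x + y)) <= Num.max (val beta (T x)) (val beta (T y)).
  apply: le_max_ppow_inv => [|n]; first by rewrite le_max gelfand_ge0.
  have [[u Eu] [v Ev]] := (frob_iter_surj n x, frob_iter_surj n y).
  have Exy : pi (T u + T v) ^+ (p ^ n) = x + y.
    rewrite rmorphD !pi_teichmuller exprD_ppow // R_Fp_algebra mul0r addr0.
    by rewrite Eu Ev.
  have [z Ez] := congr_le (leqnSn n) (teichmuller_congr Exy).
  have -> : T (x + y) = (T u + T v) ^+ (p ^ n) + p%:R ^+ n * z.
    by rewrite -Ez [RHS]addrC subrK.
  apply: le_trans (seminormD bS _ _) _; rewrite ge_max andbC.
  rewrite le_max spectrum_ppow_le orbT /= le_max; apply/orP; left.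
  have [m Em] : exists m, (p ^ n)%N = m.+1.
    by exists (p ^ n).-1; rewrite prednK // expn_gt0 prime_gt0.
  rewrite -Eu -Ev !teichmullerX Em !gelfandXS.
  have H c c' : c <= c' -> 0 <= c -> c ^+ m.+1 <= c' ^+ m.+1.
    by move=> cc c0; rewrite lerXn2r // nnegrE // (le_trans c0).
  have [uv|vu] := leP (val beta (T u)) (val beta (T v)).
    rewrite le_max; apply/orP; right; apply: H; last exact: gelfand_ge0.
    by apply: le_trans (seminormD bS _ _) _; rewrite ge_max uv lexx.
  rewrite le_max; apply/orP; left; apply: H; last exact: gelfand_ge0.
  by apply: le_trans (seminormD bS _ _) _; rewrite ge_max (ltW vu) lexx.
split.
- split=> [x||x y]; first exact: gelfand_ge0.
    by rewrite teichmuller0 gelfand_0.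
  by rewrite -(bN y) bD.
- split=> [|x y]; first by rewrite teichmuller1 gelfand_1_le.
  by rewrite teichmullerM gelfandM.
- move=> x; rewrite /trivial_norm; case: eqP => [->|_].
    by rewrite teichmuller0 gelfand_0.
  by have := spectrum_ppow_le beta 0 (T x); rewrite mul1r invr1.
Qed.

Definition mu (beta : spectrum_W) : spectrum_R :=
  exist _ ((fun x => val beta (T x)) : {ptws R -> K})
    (mem_set (mu_gelfand beta)).

Lemma lambda_is_max alpha w x : teichmuller_expansion p pi w x ->
  is_max (range (fun i : nat => q ^- i * val alpha (x i)))
         (val (lambda alpha) w).
Proof.
move=> /teichmuller_expansion_unique ->; split.
  by have [i E] := lambda_attained alpha w; exists i.
by move=> _ [i _ <-]; apply: lambda_ge.
Qed.

Lemma lambda_monotonic : monotonic lambda.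
Proof.
move=> alpha alpha' le_a w; apply/lambda_le => n i _.
apply: le_trans (le_a _) _; rewrite -ler_pdivrMr ?ppow_gt0 // mulrC.
exact: lambda_ge.
Qed.

Lemma mu_monotonic : monotonic mu.
Proof. by move=> beta beta' le_b x; apply: le_b. Qed.

Lemma muK alpha : mu (lambda alpha) = alpha.
Proof.
apply/val_inj/funext => x /=; apply/le_anti/andP; split.
  apply/lambda_le => n; rewrite -[T x]mul1r.
  by apply: (@digits_le_ppowT _ _ _ 0); rewrite ?gelfand_ge0 // mulr1.
by have := lambda_ge alpha (T x) 0; rewrite digitT invr1 mul1r.
Qed.

(** On a truncated expansion, beta(p^i) <= p^-i bounds each term by a term of the maximum, and the
    remainder has value at most p^-n. The inequality may be strict, as beta(p) can be smaller than
    p^-1. *)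
Lemma le_lambda_mu beta w : val beta w <= val (lambda (mu beta)) w.
Proof.
apply: le_max_ppow_inv => [|n]; first exact: lambda_ge0.
rewrite {1}(wsum_iter n w).
apply: le_trans (seminormD (gelfand_seminorm _) _ _) _.
rewrite ge_max !le_max spectrum_ppow_le orbT andbT; apply/orP; left.
apply: seminorm_sum => [||i]; [exact: gelfand_seminorm|exact: lambda_ge0|].
rewrite gelfandM; apply: le_trans (lambda_ge (mu beta) w i).
by rewrite ler_wpM2r ?gelfand_ge0 // -[_ ^+ i]mulr1 spectrum_ppow_le.
Qed.

(** * Strong continuity of lambda *)

Lemma lambda_le_fin alpha w c M : q ^- M <= c ->
  (forall i : 'I_M, val alpha (digit w i) <= c * q ^+ i) ->
  lambda_fun alpha w <= c.
Proof.
move=> Mc H; apply/lambda_le => n i _.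
have [iM|Mi] := ltnP i M; first exact: (H (Ordinal iM)).
apply: le_trans (spectrum_le1 _ _) _; rewrite -ler_pdivrMr ?ppow_gt0 // mul1r.
by apply: le_trans Mc; rewrite ppow_inv_le.
Qed.

Lemma lambda_digit_le alpha w i :
  val alpha (digit w i) <= lambda_fun alpha w * q ^+ i.
Proof. by rewrite -ler_pdivrMr ?ppow_gt0 // mulrC lambda_ge. Qed.

Lemma lambda_attained_fin alpha w M : q ^- M < lambda_fun alpha w ->
  exists i : 'I_M, lambda_fun alpha w = q ^- i * val alpha (digit w i).
Proof.
have [i E] := lambda_attained alpha w => Mw.
have iM : (i < M)%N.
  rewrite -(ppow_inv_lt K p_gt1); apply: lt_le_trans Mw _.
  by rewrite E lambda_term_le1.
by exists (Ordinal iM).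
Qed.

Lemma lambda_continuous : continuous lambda.
Proof.
apply: gelfand_continuous => w alpha.
have FF : Filter (nbhs alpha) := nbhs_filter alpha.
apply/(@cvgrPdist_lt _ _ _ (nbhs alpha) FF) => e e0.
have e20 : 0 < e / 2 by rewrite divr_gt0.
have [N Ne] := ppow_inv_small p_gt1 e20.
(* Closeness on the first N digits suffices, since the others weigh at most q^-N < e / 2. Halving e
   leaves room for the final strict inequality. *)
have lip alpha1 alpha2 : (forall i : 'I_N,
      `|val alpha1 (digit w i) - val alpha2 (digit w i)| < e / 2) ->
    lambda_fun alpha1 w <= lambda_fun alpha2 w + e / 2.
  move=> H; apply: (@lambda_le_fin _ _ _ N) => [|i].
    by apply: le_trans (ltW Ne) _; rewrite lerDr lambda_ge0.
  rewrite mulrDl; have := ltW (H i); rewrite ler_norml lerBlDr => /andP[_].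
  move=> /le_trans; apply; rewrite addrC lerD ?lambda_digit_le //.
  by rewrite ler_peMr ?ppow_ge1 // ltW.
have Hnear : \forall alpha' \near alpha, forall i : 'I_N,
    `|val alpha (digit w i) - val alpha' (digit w i)| < e / 2.
  apply: (@filter_forall _ _ _ (nbhs alpha) FF) => i.
  move/cvgrPdist_lt: (@continuous_gelfand_eval K R _ (digit w i) alpha).
  exact.
apply: (@filterS _ (nbhs alpha) FF _ _ _ Hnear) => alpha' H.
rewrite /= ltr_norml.
have H1 := lip alpha alpha' H.
have H2 : lambda_fun alpha' w <= lambda_fun alpha w + e / 2.
  by apply: lip => i; rewrite distrC.
have E2 : e / 2 < e by rewrite ltr_pdivrMr // mulr_natr mulr2n ltrDl.
rewrite ltrBlDl ltrBrDl ltrBlDr; apply/andP; split.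
  by apply: le_lt_trans H2 _; rewrite ltrD2l.
by apply: le_lt_trans H1 _; rewrite ltrD2l.
Qed.

Lemma lambda_weierstrass (U : set spectrum_W) :
  weierstrass U -> finite_union_of (@weierstrass K R _) (lambda @^-1` U).
Proof.
move=> [n [f [c [c0 ->]]]]; have [M Mc] := ppow_inv_small_fin p_gt1 c0.
apply: finite_union_of1.
have -> : lambda @^-1` [set beta | forall i, val beta (f i) <= c i] =
    [set alpha | forall ik : 'I_n * 'I_M,
       val alpha (digit (f ik.1) ik.2) <= c ik.1 * q ^+ ik.2].
  apply/seteqP; split=> alpha /= H => [[i k]|i] /=.
    by move/lambda_le: (H i) => /(_ k.+1); apply.
  by apply: lambda_le_fin (ltW (Mc i)) _ => k; apply: (H (i, k)).
by apply: weierstrass_fin => ik; rewrite mulr_gt0 ?ppow_gt0.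
Qed.

(** A lower bound d j can only be reached at one of the first M2 digits of g j, the others weighing
    less. The functions phi selecting such a digit for each j index the union. *)
Lemma lambda_laurent (U : set spectrum_W) :
  laurent U -> finite_union_of (@laurent K R _) (lambda @^-1` U).
Proof.
move=> [m [n [f [c [g [d [c0 d0 ->]]]]]]].
have [M1 M1c] := ppow_inv_small_fin p_gt1 c0.
have [M2 M2d] := ppow_inv_small_fin p_gt1 d0.
have -> : lambda @^-1` [set beta | (forall i, val beta (f i) <= c i) /\
                                   (forall j, d j <= val beta (g j))] =
    \bigcup_(phi : {ffun 'I_n -> 'I_M2})
    [set alpha | (forall ik : 'I_m * 'I_M1,
         val alpha (digit (f ik.1) ik.2) <= c ik.1 * q ^+ ik.2) /\
       (forall j, d j * q ^+ phi j <= val alpha (digit (g j) (phi j)))].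
  apply/seteqP; split=> alpha /=.
    move=> [H H'].
    have /choice[phi phiP] j : exists i : 'I_M2,
        d j * q ^+ i <= val alpha (digit (g j) i).
      have [i E] := lambda_attained_fin (lt_le_trans (M2d j) (H' j)).
      by exists i; rewrite -ler_pdivlMr ?ppow_gt0 // mulrC -E H'.
    exists [ffun j => phi j] => //; split=> [[i k]|j]; last by rewrite ffunE.
    by move/lambda_le: (H i) => /(_ k.+1); apply.
  move=> [phi _ [H H']]; split=> i.
    by apply: lambda_le_fin (ltW (M1c i)) _ => k; apply: (H (i, k)).
  apply: le_trans (lambda_ge alpha (g i) (phi i)).
  by rewrite mulrC ler_pdivlMr ?ppow_gt0.
apply: finite_union_of_fin => phi.
by apply: laurent_fin => [ik|j]; rewrite mulr_gt0 ?ppow_gt0.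
Qed.

Lemma witt_is_completion :
  is_completion (@padic_norm K p W) (@padic_norm K p W) idfun.
Proof.
by apply: padic_is_completion => //;
  [exact: witt_separated W_witt|exact: witt_complete W_witt].
Qed.

(** The coefficients have value at most 1, so if every f i had value below 1, the ultrametric
    inequality would give 1 a value below 1. *)
Lemma spectrum_unit_ideal (alpha : spectrum_R) (I : finType) (c f : I -> R) :
  val alpha 1 = 1 -> \sum_i c i * f i = 1 -> exists i, 1 <= val alpha (f i).
Proof.
move=> a1 cf; apply/not_existsP => H.
suff : val alpha (\sum_i c i * f i) < 1 by rewrite cf a1 ltxx.
apply: (big_ind (fun x => val alpha x < 1)) => [|x y x1 y1|i _].
- by rewrite gelfand_0.
- apply: le_lt_trans (seminormD (gelfand_seminorm _) _ _) _.
  by rewrite gt_max x1.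
- rewrite gelfandM; apply: le_lt_trans (_ : val alpha (f i) < 1).
    by rewrite ler_piMl ?gelfand_ge0 ?spectrum_le1.
  by rewrite ltNge; apply/negP/H.
Qed.

(* On a nonzero alpha satisfying the inequalities, the unit ideal condition
   bounds lambda(alpha)(g) below, so that it is attained at one of the first M
   digits of g; the pieces of the union are indexed by this digit. *)
Lemma lambda_rational (U : set spectrum_W) :
  Defs.rational U -> finite_union_of (@Defs.rational K R _) (lambda @^-1` U).
Proof.
move=> [n [f [g [c [fg c0 ->]]]]].
have [u [v uv]] := unit_ideal_of_complete witt_is_completion fg.
(* The extra index adds g to the family with constant 1, so that the unit ideal relation and the
   digit inequalities run over one index type. *)
pose I := ('I_n + unit)%type.
pose F (o : I) := if o is inl i then f i else g.
pose C (o : I) := if o is inl i then c i else 1.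
pose V (o : I) := pi (if o is inl i then u i else v).
have C0 o : 0 < C o by case: o => [i|_] //=; apply: c0.
have VF : \sum_o V o * pi (F o) = 1.
  rewrite big_sumType /= (big_pred1 tt) => [|[]//].
  rewrite /V /= -rmorphM; under eq_bigr do rewrite -rmorphM.
  by rewrite -rmorph_sum -rmorphD uv rmorph1.
(* Pairs (inr tt, o) will confine the maximum for g to its first M digits; pairs (inl i, o) will
   make the digits of f i from M on negligible. *)
have [M MC] := ppow_inv_small_fin p_gt1
  (fun oo : I * I => divr_gt0 (C0 oo.1) (C0 oo.2)).
have M0 : (0 < M)%N.
  rewrite lt0n; apply/eqP => M_eq0; have := MC (inr tt, inr tt).
  by rewrite M_eq0 /= divr1 invr1 ltxx.
have MCV o : q ^- M < (C o)^-1 by have := MC (inr tt, o); rewrite /= mul1r.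
have -> : lambda @^-1`
      [set beta | forall i, val beta (f i) <= c i * val beta g] =
    \bigcup_(j : 'I_M) [set alpha | forall ok : I * 'I_M,
       val alpha (digit (F ok.1) ok.2) <=
         C ok.1 * q ^+ ok.2 * q ^- j * val alpha (digit g j)].
  apply/seteqP; split=> alpha /=.
    move=> H; have [a1|a0] := gelfand_eq0_or1 alpha; last first.
      (* The zero seminorm lies in every piece, so any index serves. *)
      by exists (Ordinal M0) => // ok; rewrite !a0 mulr0.
    have HF o : lambda_fun alpha (F o) <= C o * lambda_fun alpha g.
      by case: o => [i|[]]; [exact: H|rewrite mul1r].
    have [t t1] := spectrum_unit_ideal a1 VF.
    have [|j Ej] := @lambda_attained_fin alpha g M.
      apply: lt_le_trans (MCV t) _; rewrite -[X in X <= _]mulr1 ler_pdivrMl //.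
      apply: le_trans (HF t); apply: le_trans t1 _.
      by have := lambda_digit_le alpha (F t) 0; rewrite mulr1.
    exists j => // -[t' k] /=; apply: le_trans (lambda_digit_le _ _ _) _.
    by rewrite -!mulrA -Ej [_ * lambda_fun _ g]mulrC mulrA ler_wpM2r.
  move=> [j _ H] i; have [a1|a0] := gelfand_eq0_or1 alpha; last first.
    apply/lambda_le => N k _; rewrite a0.
    apply: mulr_ge0; last by rewrite ltW ?ppow_gt0.
    by rewrite mulr_ge0 ?lambda_ge0 // ltW.
  have [t t1] := spectrum_unit_ideal a1 VF.
  pose s := q ^- j * val alpha (digit g j).
  (* The leading digit of F t has value at least 1, and its inequality bounds the weight s of digit
     j of g from below. *)
  have st : (C t)^-1 <= s.
    rewrite -[X in X <= _]mulr1 ler_pdivrMl //; apply: le_trans t1 _.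
    by have := H (t, Ordinal M0); rewrite /= mulr1 -mulrA.
  have sg : c i * s <= c i * lambda_fun alpha g.
    by rewrite ler_pM2l // lambda_ge.
  apply: le_trans sg; apply: (@lambda_le_fin _ _ _ M) => [|k].
    apply: le_trans (ltW (MC (inl i, t))) _ => /=.
    by rewrite ler_pM2l.
  apply: le_trans (H (inl i, k)) _ => /=.
  by rewrite /s -!mulrA ler_pM2l // mulrC -mulrA.
apply: finite_union_of_fin => j; apply: rational_fin => [||ok].
- exact: trivial_is_completion.
(* Only leading digits get a nonzero coefficient: they are the reductions of the f i and of g, which
   satisfy the reduced relation [VF]. *)
- exists (fun ok : I * 'I_M => if val ok.2 == 0%N then V ok.1 else 0), 0.
  rewrite mul0r addr0 -VF -(pair_bigA _ (fun (o : I) (k : 'I_M) =>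
    (if val k == 0%N then V o else 0) * digit (F o) k)) /=.
  apply: eq_bigr => o _; rewrite (bigD1 (Ordinal M0)) //= big1 ?addr0 //.
  move=> k k0.
  by rewrite ifN ?mul0r.
- by rewrite !mulr_gt0 ?ppow_inv_gt0 ?ppow_gt0.
Qed.

(** * Strong continuity of mu *)

Lemma mu_continuous : continuous mu.
Proof. by apply: gelfand_continuous => x; apply: continuous_gelfand_eval. Qed.

Lemma mu_weierstrass (U : set spectrum_R) :
  weierstrass U -> finite_union_of (@weierstrass K W _) (mu @^-1` U).
Proof.
move=> [n [f [c [c0 ->]]]]; apply: finite_union_of1.
by exists n, (T \o f), c.
Qed.

Lemma mu_laurent (U : set spectrum_R) :
  laurent U -> finite_union_of (@laurent K W _) (mu @^-1` U).
Proof.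
move=> [m [n [f [c [g [d [c0 d0 ->]]]]]]]; apply: finite_union_of1.
by exists m, n, (T \o f), c, (T \o g), d.
Qed.

Lemma mu_rational (U : set spectrum_R) :
  Defs.rational U -> finite_union_of (@Defs.rational K W _) (mu @^-1` U).
Proof.
move=> [n [f [g [c [fg c0 ->]]]]]; apply: finite_union_of1.
exists n, (T \o f), (T g), c; split=> //.
have [u [v uv]] := unit_ideal_of_complete (trivial_is_completion K R) fg.
(* The lifted relation holds only modulo p; its left side 1 + p y is a unit, and its inverse z
   rescales the coefficients. *)
have [y] : cg 1 (\sum_i T (u i) * T (f i) + T v * T g) 1.
  apply/pi_eq; rewrite rmorph1 -uv rmorphD rmorph_sum rmorphM !pi_teichmuller.
  by congr (_ + _); apply: eq_bigr => i _; rewrite rmorphM !pi_teichmuller.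
rewrite expr1 => /eqP; rewrite subr_eq [X in _ == X]addrC => /eqP E.
have [z Ez] := unit_one_add_pmul y; rewrite -E in Ez.
exists W, (@padic_norm K p W), idfun; split; first exact: witt_is_completion.
exists (fun i => z * T (u i)), (z * T v).
rewrite -Ez [RHS]mulrC mulrDr mulr_sumr mulrA.
by congr (_ + _); apply: eq_bigr => i _; rewrite mulrA.
Qed.

End Lambda.
End WittRings.

Theorem theorem4p5 (K : realType) (p : nat) (R W : comPzRingType)
    (pi : {rmorphism W -> R})
    (p_prime : prime p)
    (R_Fp_algebra : p%:R = 0 :> R)
    (R_perfect : bijective (fun x : R => x ^+ p))
    (W_witt : is_witt_ring p pi) :
  exists (lambda : gelfand (@trivial_norm K R) -> gelfand (@padic_norm K p W))
         (mu : gelfand (@padic_norm K p W) -> gelfand (@trivial_norm K R)),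
    [/\ forall (alpha : gelfand (@trivial_norm K R)) (w : W) (x : nat -> R),
          teichmuller_expansion p pi w x ->
          is_max (range (fun i : nat => p%:R ^- i * val alpha (x i)))
                 (val (lambda alpha) w)
      & forall (beta : gelfand (@padic_norm K p W)) (x : R),
          val (mu beta) x = val beta (teichmuller p pi x)] /\
    [/\ [/\ strongly_continuous lambda, strongly_continuous mu,
            monotonic lambda & monotonic mu],
        forall alpha, mu (lambda alpha) = alpha
      & forall (beta : gelfand (@padic_norm K p W)) (w : W),
          val beta w <= val (lambda (mu beta)) w].
Proof.
exists (lambda p_prime R_Fp_algebra R_perfect W_witt (K := K)).
exists (mu p_prime R_Fp_algebra R_perfect W_witt (K := K)).
split; first by split=> // alpha w x; apply: lambda_is_max.
split; [split| |].
- split; [exact: lambda_continuous|exact: lambda_weierstrass|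
    exact: lambda_laurent|exact: lambda_rational].
- split; [exact: mu_continuous|exact: mu_weierstrass|
    exact: mu_laurent|exact: mu_rational].
- exact: lambda_monotonic.
- exact: mu_monotonic.
- exact: muK.
- exact: le_lambda_mu.
Qed.
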